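(* Let $\Omega=\mathbb T^d$, fix a (periodic) simplicial mesh $\mathcal T_h$ of $\Omega$ in dimension $d$ and let $q\ge d$. For every $C_0>0$ there is $c_h(C_0)>0$ such that every $v_h\in V_h$ satisfying $$v_h>0\ \text{on }\overline\Omega,\qquad \int_\Omega v_h\,dx+\int_\Omega v_h^{-q}\,dx\le C_0$$ obeys $$\min_{\overline\Omega}v_h\ge c_h(C_0).$$ The constant is permitted to depend on the fixed mesh. If $q<d$, the conclusion is false in general.
   Context: $\Omega=\mathbb T^d$ is the flat torus, $1\le d\le3$. $V_h$ is the space of continuous periodic functions on $\Omega$ that are affine on each simplex of the mesh $\mathcal T_h$. ''False in general'' means: for exponents $q<d$ it is not true in general that for every $C_0>0$ a positive constant $c_h(C_0)$ with the stated property exists. *)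

(* Defs.v *)
From HB Require Import structures.
From mathcomp Require Import all_boot all_order all_algebra.
From mathcomp Require Import all_classical all_reals all_analysis.

Set Implicit Arguments.
Unset Strict Implicit.
Unset Printing Implicit Defensive.

Import Order.TTheory GRing.Theory Num.Theory.
Import numFieldNormedType.Exports.

Local Open Scope classical_set_scope.
Local Open Scope ring_scope.

(* The torus T^d is R^d / Z^d: its points are the row vectors 'rV[R]_d modulo
   integer vectors, functions on it are Z^d-periodic functions on R^d, and
   integrals over it are integrals over the unit cube. *)

Section Torus.
Variables (R : realType) (d : nat).

Definition periodic (f : 'rV[R]_d -> R) : Prop :=
  forall (x : 'rV[R]_d) (z : 'rV[int]_d), f (x + map_mx intr z) = f x.

(* The d-fold product of the Lebesgue measure on R. It lives on d-tuples, which,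
   unlike row vectors, carry the product sigma-algebra in the library. *)
Fixpoint lebesgue_tuple (n : nat) :
    set (n.-tuple (measurableTypeR R)) -> \bar R :=
  match n with
  | 0 => \d_ [tuple]
  | n'.+1 => pushforward (lebesgue_measure \x @lebesgue_tuple n')%E
               (fun p : measurableTypeR R * n'.-tuple (measurableTypeR R) =>
                  [tuple of p.1 :: p.2])
  end.

Definition unit_cube : set (d.-tuple (measurableTypeR R)) :=
  [set t | forall i, (0 : R) <= tnth t i <= 1].

Definition torus_integral (f : 'rV[R]_d -> R) : \bar R :=
  (\int[@lebesgue_tuple d]_(t in unit_cube) (f (\row_i tnth t i))%:E)%E.

End Torus.

Section Mesh.
Variables (R : realType) (d : nat).

(* A d-simplex is given by its d + 1 vertices, the rows of S. *)

Definition nondegenerate (S : 'M[R]_(d.+1, d)) : Prop :=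
  row_free (\matrix_(i < d) (row (lift ord0 i) S - row ord0 S)).

Definition face (S : 'M[R]_(d.+1, d)) (I : {set 'I_d.+1}) : set 'rV[R]_d :=
  [set x | exists w : 'rV[R]_d.+1,
     [/\ forall i, 0 <= w ord0 i, forall i, i \notin I -> w ord0 i = 0,
         \sum_i w ord0 i = 1 & x = w *m S]].

Definition hull (S : 'M[R]_(d.+1, d)) : set 'rV[R]_d := face S [set: 'I_d.+1].

Definition translate (S : 'M[R]_(d.+1, d)) (z : 'rV[int]_d) :
  'M[R]_(d.+1, d) := \matrix_i (row i S + map_mx intr z).

(* A periodic simplicial mesh is a finite list of simplices whose translates by
   Z^d form a conforming triangulation of R^d. Two of these simplices meet in a
   common face, which is empty if I and J are. A simplex may have two vertices
   that differ by an integer vector, as in the triangulation of the unit square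
   by a diagonal. *)
Record periodic_mesh := PeriodicMesh {
  simplices :> seq 'M[R]_(d.+1, d);
  _ : forall S, S \in simplices -> nondegenerate S;
  _ : forall x : 'rV[R]_d, exists S (z : 'rV[int]_d),
        S \in simplices /\ hull (translate S z) x;
  _ : forall S1 S2 (z1 z2 : 'rV[int]_d),
        S1 \in simplices -> S2 \in simplices ->
        let K1 := translate S1 z1 in let K2 := translate S2 z2 in
        exists I J : {set 'I_d.+1},
          hull K1 `&` hull K2 = face K1 I /\ hull K1 `&` hull K2 = face K2 J
}.

Definition affine_on (K : set 'rV[R]_d) (f : 'rV[R]_d -> R) : Prop :=
  exists (a : 'cV[R]_d) (b : R), forall x, K x -> f x = (x *m a) ord0 ord0 + b.

Definition Vh (T : periodic_mesh) : set ('rV[R]_d -> R) :=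
  [set v | [/\ continuous v, periodic v &
               forall S z, S \in simplices T ->
                 affine_on (hull (translate S z)) v]].

(* The minimum of v is inf (range v): a continuous periodic function attains
   its infimum. *)
Definition has_lower_bound (T : periodic_mesh) (q C0 : R) : Prop :=
  exists2 c : R, 0 < c &
    forall v, Vh T v -> (forall x, 0 < v x) ->
      (torus_integral v + torus_integral (fun x => (v x `^ (- q))%R) <= C0%:E)%E ->
      c <= inf (range v).

End Mesh.

(* Main.v *)
Require Import Defs.
From HB Require Import structures.
From mathcomp Require Import all_boot all_order all_algebra.
From mathcomp Require Import fingroup perm.
From mathcomp Require Import all_classical all_reals all_analysis.
From mathcomp Require Import measurable_realfun.
From mathcomp Require Import zify ring lra.

Set Implicit Arguments.
Unset Strict Implicit.
Unset Printing Implicit Defensive.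

Import Order.TTheory GRing.Theory Num.Theory.
Import numFieldNormedType.Exports.

Local Open Scope classical_set_scope.
Local Open Scope ring_scope.

(** For [q >= d]: a positive function [v] in [V_h] is determined on a simplex by
its vertex values, which [int v <= C0] bounds by some [M].  Near a vertex [p],
at scale [t = 2^-k], we have [v <= v p + t M], so the part of the simplex at that
scale, of volume of order [t^d], contributes at least a constant times
[t^(d - q) >= 1] to [int v^-q] as long as [t >= v p].  Hence the number of such
dyadic scales is bounded, and [v p] is bounded below.

For [q < d]: on the Freudenthal triangulation of mesh size 1/2, the functions
[eps + \sum_j dist (x_j, Z)] belong to [V_h] and have minimum [eps].  Since
[(eps + \sum_j y_j)^-q <= \prod_j (eps + y_j)^(-q/d)] for [q >= 0], Tonelli's
theorem bounds the integrals of their powers uniformly in [eps]. *)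

(** * Integration against Lebesgue measure on tuples *)

(** Measurability is not assumed: the integral of a nonnegative function is a supremum over the
    simple functions below it, and those below [f] are also below [g]. *)
Lemma ge0_le_integral_nomeas d (T : measurableType d) (R : realType)
    (mu : {measure set T -> \bar R}) (D : set T) (f g : T -> \bar R) :
  (forall x, D x -> 0 <= f x)%E -> (forall x, D x -> f x <= g x)%E ->
  (\int[mu]_(x in D) f x <= \int[mu]_(x in D) g x)%E.
Proof.
move=> f0 fg; rewrite integral_mkcond [leRHS]integral_mkcond.
have f0' x : (0 <= (f \_ D) x)%E by apply: erestrict_ge0.
have fg' x : ((f \_ D) x <= (g \_ D) x)%E by exact: lee_restrict.
rewrite !ge0_integralTE//; last by move=> x; exact: le_trans (fg' x).
by apply: ereal_sup_le => _ [h hf <-]; exists h => // x; exact: le_trans (fg' x).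
Qed.

Section LebesgueTuple.
Variable R : realType.
Local Notation mR := (measurableTypeR R).
Local Notation lambda := (@lebesgue_tuple R).

Definition box n (a b : 'I_n -> R) : set (n.-tuple mR) :=
  [set t | forall i, a i <= tnth t i <= b i].

Lemma measurable_box n (a b : 'I_n -> R) : measurable (box a b).
Proof.
rewrite (_ : box a b =
   \bigcap_(i in [set: 'I_n]) ((fun t : n.-tuple mR => tnth t i) @^-1` `[a i, b i])).
  apply: fin_bigcap_measurable => // i _.
  rewrite -[X in measurable X]setTI; apply: measurable_tnth => //.
apply/seteqP; split=> t /=.
  by move=> h i _ /=; rewrite in_itv/= h.
by move=> h i; have := h i Logic.I; rewrite /= in_itv.
Qed.

Definition cons_tuple n (p : mR * n.-tuple mR) : n.+1.-tuple mR :=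
  [tuple of p.1 :: p.2].

Lemma measurable_cons_tuple n :
  measurable_fun [set: mR * n.-tuple mR] (@cons_tuple n).
Proof. exact: measurable_cons. Qed.

Lemma preimage_cons_tuple_box n (a b : 'I_n.+1 -> R) :
  @cons_tuple n @^-1` box a b =
  `[a ord0, b ord0]%classic `*` box (a \o lift ord0) (b \o lift ord0).
Proof.
apply/seteqP; split=> [[x t]|[x t]] /=.
  move=> h; split; first by have := h ord0; rewrite /= in_itv.
  by move=> i /=; have := h (lift ord0 i); rewrite tnthS.
rewrite in_itv/= => -[hx h] i; have := unliftP ord0 i.
move=> [j ->|-> //].
by rewrite tnthS; exact: h.
Qed.


(** Measure structure and box volumes go through one induction: sigma-finiteness in dimension [n.+1]
    is read off from the cubes [[-k, k]^n.+1], which exhaust the space and have finite volume, and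
    it is needed to form the next product. *)
Lemma lebesgue_tuple_spec n :
  exists2 m : {sigma_finite_measure set (n.-tuple mR) -> \bar R},
    @lambda n = m &
    forall a b : 'I_n -> R, (forall i, a i <= b i) ->
      m (box a b) = (\prod_i (b i - a i))%:E.
Proof.
elim: n => [|n [m mE IH]] /=.
  exists (\d_ [tuple])%E => // a b _; rewrite big_ord0 /= diracE.
  by rewrite mem_set//; case.
rewrite mE.
pose p : {measure set (mR * n.-tuple mR)%type -> \bar R} := ((@lebesgue_measure R) \x m)%E.
pose mup : {measure set (n.+1.-tuple mR) -> \bar R} :=
  measure_function_pushforward__canonical__measure_function_Measure p (@measurable_cons_tuple n).
have boxE (a b : 'I_n.+1 -> R) : (forall i, a i <= b i) ->
    mup (box a b) = (\prod_i (b i - a i))%:E.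
  move=> ab; rewrite /mup /= /pushforward preimage_cons_tuple_box.
  rewrite product_measure1E//; last exact: measurable_box.
  rewrite /= IH; last by move=> i; exact: ab.
  rewrite lebesgue_measure_itv/= lte_fin big_ord_recl EFinM.
  have := ab ord0; rewrite le_eqVlt => /predU1P[->|->]; last by rewrite EFinB.
  by rewrite ltxx subrr.
have sf : sigma_finite [set: n.+1.-tuple mR] mup.
  exists (fun k => box (fun=> - k%:R) (fun=> k%:R)).
    apply/esym/seteqP; split=> // t _.
    pose M := \sum_i `|tnth t i|.
    exists (Num.truncn M).+1 => // i /=.
    rewrite -ler_norml; apply: (le_trans _ (ltW (truncnS_gt _))).
    by rewrite /M (bigD1 i)//= lerDl sumr_ge0.
  move=> k; split; first exact: measurable_box.
  by rewrite boxE ?ltry// => i; rewrite lerNl (le_trans _ (ler0n _ _))// oppr_le0.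
pose sfm := Measure_isSigmaFinite.Build _ _ _ mup sf.
pose M : {sigma_finite_measure set (n.+1.-tuple mR) -> \bar R} :=
  HB.pack (Measure.sort mup) (Measure.class mup) sfm.
by exists M.
Qed.

Definition lebesgue_tuple_measure n :
  {sigma_finite_measure set (n.-tuple mR) -> \bar R} :=
  s2val (cid2 (lebesgue_tuple_spec n)).

Lemma lebesgue_tupleE n : @lambda n = lebesgue_tuple_measure n.
Proof. exact: s2valP (cid2 (lebesgue_tuple_spec n)). Qed.

Lemma lebesgue_tuple_box n (a b : 'I_n -> R) : (forall i, a i <= b i) ->
  @lambda n (box a b) = (\prod_i (b i - a i))%:E.
Proof.
by rewrite lebesgue_tupleE; exact: s2valP' (cid2 (lebesgue_tuple_spec n)) a b.
Qed.

(** Tonelli splits off the first coordinate: the inner integral is [g x * K] with [K] independent of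
    [x], so each coordinate costs one factor [C]. *)
Lemma lebesgue_tuple_integral_prod (g : mR -> R) (C : R) :
  measurable_fun [set: mR] g -> (forall x, 0 <= g x) ->
  (\int[@lebesgue_measure R]_x (g x)%:E <= C%:E)%E ->
  forall n, (\int[@lambda n]_t (\prod_i g (tnth t i))%:E <= (C ^+ n)%:E)%E.
Proof.
move=> mg g0 gC.
have mprod n : measurable_fun [set: n.-tuple mR]
    (fun t : n.-tuple mR => \prod_i g (tnth t i) : R).
  apply: measurable_prod => i _.
  exact: (measurableT_comp mg (measurable_tnth i)).
have prod0 n (t : n.-tuple mR) : 0 <= \prod_i g (tnth t i) by exact: prodr_ge0.
have C0 : 0 <= C.
  by rewrite -lee_fin; apply: le_trans gC; apply: integral_ge0 => x _; rewrite lee_fin.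
elim=> [|n IH].
  rewrite /= expr0 integral_dirac//; last first.
    apply/measurable_EFinP. exact: (mprod 0).
  by rewrite diracT mul1e big_ord0.
rewrite /= lebesgue_tupleE -/(@cons_tuple n).
rewrite ge0_integral_pushforward//=; last 3 first.
- exact: measurable_cons_tuple.
- apply/measurable_EFinP; exact: (mprod n.+1).
- by move=> t _; rewrite lee_fin; exact: prod0.
rewrite preimage_setT fubini_tonelli1//=; last 2 first.
- apply/measurable_EFinP; apply: (measurableT_comp (mprod n.+1)).
  exact: measurable_cons_tuple.
- by move=> t; rewrite lee_fin; exact: prod0.
rewrite /fubini_F /=.
have consE (x : mR) (t : n.-tuple mR) : \prod_i g (tnth (cons_tuple (x, t)) i) =
    g x * \prod_i g (tnth t i).
  by rewrite big_ord_recl; congr (_ * _); apply: eq_bigr => i _; rewrite tnthS.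
pose K := (\int[lebesgue_tuple_measure n]_t (\prod_i g (tnth t i))%:E)%E.
have K0 : (0 <= K)%E.
  by apply: integral_ge0 => t _; rewrite lee_fin; exact: prod0.
rewrite (eq_integral (fun x => (g x)%:E * K)%E); last first.
  move=> x _; rewrite /K -ge0_integralZl//=.
  - by apply: eq_integral => t _; rewrite consE.
  - apply/measurable_EFinP; exact: mprod.
  - by move=> t _; rewrite lee_fin; exact: prod0.
  - by rewrite lee_fin.
rewrite ge0_integralZr//=; last 2 first.
- exact/measurable_EFinP.
- by move=> x _; rewrite lee_fin.
rewrite exprS EFinM; apply: lee_pmul => //.
  by apply: integral_ge0 => x _; rewrite lee_fin.
by rewrite /K -lebesgue_tupleE.
Qed.
End LebesgueTuple.

(** Since the boxes are disjoint, the step function summing [c k] times the indicator of box [k]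
    never adds two levels, so it stays below [f] on [D]. *)
Lemma sum_boxes_le_integral (R : realType) n N (D : set (n.-tuple (measurableTypeR R)))
    (c : 'I_N -> R) (a b : 'I_N -> 'I_n -> R)
    (f : n.-tuple (measurableTypeR R) -> R) :
  measurable D -> (forall t, D t -> 0 <= f t) ->
  (forall k, 0 <= c k) -> (forall k i, a k i <= b k i) ->
  (forall k, box (a k) (b k) `<=` D) ->
  (forall k t, box (a k) (b k) t -> c k <= f t) ->
  (forall k l t, box (a k) (b k) t -> box (a l) (b l) t -> k = l) ->
  ((\sum_k c k * \prod_i (b k i - a k i))%:E
     <= \int[@lebesgue_tuple R n]_(t in D) (f t)%:E)%E.
Proof.
move=> mD f0 c0 ab BD cf disj.
pose g k (t : n.-tuple (measurableTypeR R)) : \bar R :=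
  (c k * \1_(box (a k) (b k)) t)%:E.
have g0 k t : (0 <= g k t)%E by rewrite lee_fin mulr_ge0.
have ig k : (\int[@lebesgue_tuple R n]_(t in D) g k t)%E =
    (c k * \prod_i (b k i - a k i))%:E.
  rewrite lebesgue_tupleE /g; under eq_integral do rewrite EFinM.
  rewrite ge0_integralZl//.
  - rewrite integral_indic//; last exact: measurable_box.
    rewrite (setIidl (BD k)) EFinM; congr (_ * _)%E.
    by have := lebesgue_tuple_box (ab k); rewrite lebesgue_tupleE => <-.
  - apply/measurable_EFinP; apply: measurable_indic; exact: measurable_box.
  - by rewrite lee_fin.
rewrite -sumEFin; under eq_bigr => k _ do rewrite -ig.
rewrite lebesgue_tupleE -ge0_integral_sum//; last first.
  move=> k; apply/measurable_EFinP; apply: measurable_funM => //.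
  by apply: measurable_indic; exact: measurable_box.
apply: ge0_le_integral_nomeas => t Dt; first exact: sume_ge0.
rewrite /g sumEFin lee_fin.
have [[k kt]|nex] := pselect (exists k, box (a k) (b k) t).
  rewrite (bigD1 k)//= big1 ?addr0 => [|l lk].
    by rewrite indicE mem_set// mulr1 cf.
  rewrite indicE memNset ?mulr0// => lt.
  by move: lk; rewrite (disj _ _ _ lt kt) eqxx.
rewrite big1 ?f0// => k _; rewrite indicE memNset ?mulr0// => kt.
by apply: nex; exists k.
Qed.

(** * Uniform positive constants over finite families *)

(** A minimum of finitely many positive constants is positive, and [P x] survives shrinking the
    constant. This makes the constants uniform over the simplices of a mesh. *)
Lemma seq_uniform_gt0 (R : realType) (X : eqType) (s : seq X) (P : X -> R -> Prop) :
  (forall x c c', 0 < c' -> c' <= c -> P x c -> P x c') ->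
  (forall x, x \in s -> exists2 c, 0 < c & P x c) ->
  exists2 c, 0 < c & forall x, x \in s -> P x c.
Proof.
move=> mono; elim: s => [|x s IH] h; first by exists 1.
have [c1 c10 Pc1] := h x (mem_head _ _).
have [c2 c20 Pc2] : exists2 c, 0 < c & forall y, y \in s -> P y c.
  by apply: IH => y ys; apply: h; rewrite inE ys orbT.
have m0 : 0 < Num.min c1 c2 by rewrite lt_min c10.
exists (Num.min c1 c2) => // y; rewrite inE => /orP[/eqP->|ys].
  by apply: mono Pc1 => //; rewrite ge_min lexx.
by apply: mono (Pc2 _ ys) => //; rewrite ge_min lexx orbT.
Qed.

Lemma fin_uniform_gt0 (R : realType) (X : finType) (P : X -> R -> Prop) :
  (forall x c c', 0 < c' -> c' <= c -> P x c -> P x c') ->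
  (forall x, exists2 c, 0 < c & P x c) ->
  exists2 c, 0 < c & forall x, P x c.
Proof.
move=> mono h.
have [c c0 Pc] := seq_uniform_gt0 (s := enum X) mono (fun x _ => h x).
by exists c => // x; apply: Pc; rewrite mem_enum.
Qed.

(** * Barycentric geometry of one simplex *)

Section Simplex.
Variables (R : realType) (d : nat).
Implicit Types (S K : 'M[R]_(d.+1, d)) (v : 'rV[R]_d -> R) (w : 'rV[R]_d.+1).

(** The box is centred at the barycentre, whose barycentric coordinates all equal [e = 1 / (d + 1)].
    Moving the last [d] of them by at most [e ^+ 2] keeps them nonnegative, and their sum stays at
    most [d * (e + e ^+ 2) = 1 - e ^+ 2]. *)
Lemma hull_interior_box S : Defs.nondegenerate S ->
  exists c : 'rV[R]_d, exists2 r : R, 0 < r &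
    forall x : 'rV[R]_d, (forall j, `|x ord0 j - c ord0 j| <= r) -> hull S x.
Proof.
rewrite /Defs.nondegenerate; set A := (X in row_free X); rewrite row_free_unit => uA.
pose e : R := d.+1%:R^-1.
have e0 : 0 < e by rewrite invr_gt0.
have de : d.+1%:R * e = 1 by rewrite mulfV.
pose M : R := \sum_i \sum_j `|invmx A i j| + 1.
have M0 : 0 < M by rewrite ltr_wpDl// sumr_ge0// => i _; rewrite sumr_ge0.
pose c := row ord0 S + const_mx e *m A.
(* [M] dominates every column sum of absolute values of [invmx A], so a displacement of size
   [e ^+ 2 / M] changes each coordinate [u] by at most [e ^+ 2]. *)
exists c; exists (e ^+ 2 / M); first by rewrite divr_gt0// exprn_gt0.
move=> x xc.
pose u := (x - row ord0 S) *m invmx A.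
have uE j : `|u ord0 j - e| <= e ^+ 2.
  have -> : u ord0 j - e = ((x - c) *m invmx A) ord0 j.
    by rewrite /c opprD addrA mulmxBl mulmxK// !mxE.
  rewrite mxE; apply: le_trans (ler_norm_sum _ _ _) _.
  apply: (@le_trans _ _ (\sum_k e ^+ 2 / M * `|invmx A k j|)).
    apply: ler_sum => k _; rewrite normrM ler_wpM2r//.
    by have := xc k; rewrite !mxE.
  rewrite -mulr_sumr mulrAC ler_pdivrMr// ler_wpM2l ?sqr_ge0//.
  rewrite /M ler_wpDr//; apply: ler_sum => k _.
  by rewrite (bigD1 j)//= lerDl sumr_ge0.
have ux : x = row ord0 S + u *m A by rewrite /u mulmxKV// addrC subrK.
have ele1 : e <= 1 by rewrite invf_le1// ler1n.
pose w : 'rV[R]_d.+1 :=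
  \row_i oapp (fun j => u ord0 j) (1 - \sum_j u ord0 j) (unlift ord0 i).
have w0 o : w o ord0 = 1 - \sum_j u ord0 j by rewrite mxE unlift_none.
have wS o j : w o (lift ord0 j) = u ord0 j by rewrite mxE liftK.
exists w; split.
- move=> i; have := unliftP ord0 i; move=> [j ->|->].
    rewrite wS; have := uE j; rewrite ler_norml => /andP[+ _].
    rewrite expr2; nra.
  rewrite w0 subr_ge0.
  apply: (@le_trans _ _ (\sum_(j < d) (e + e ^+ 2))).
    by apply: ler_sum => j _; have := uE j; rewrite ler_norml; lra.
  rewrite sumr_const card_ord -[_ *+ d]mulr_natl.
  move: de; rewrite -natr1; set D : R := d%:R; have : 0 <= D by rewrite ler0n.
  by move=> ? ?; nra.
- by move=> i; rewrite inE.
- rewrite big_ord_recl w0 [X in _ + X](eq_bigr (u ord0)) ?subrK//.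
rewrite mulmx_sum_row big_ord_recl w0.
under [X in _ + X]eq_bigr do rewrite wS.
rewrite ux mulmx_sum_row scalerBl scale1r scaler_suml -addrA; congr (_ + _).
rewrite addrC -sumrB; apply: eq_bigr => j _; rewrite -scalerBr; congr (_ *: _).
by rewrite rowK.
Qed.


Lemma row_hull K i : hull K (row i K).
Proof.
exists (delta_mx ord0 i); split.
- by move=> j; rewrite !mxE ler0n.
- by move=> j; rewrite inE.
- by rewrite (bigD1 i)//= big1 ?mxE ?eqxx ?addr0// => j ji; rewrite mxE (negPf ji).
- by rewrite rowE.
Qed.

Lemma affine_on_hullE K v w : affine_on (hull K) v ->
  (forall i, 0 <= w ord0 i) -> \sum_i w ord0 i = 1 ->
  v (w *m K) = \sum_i w ord0 i * v (row i K).
Proof.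
move=> [a [b vE]] w0 w1; rewrite vE; last by exists w; split => // i; rewrite inE.
under eq_bigr => i _ do rewrite (vE _ (row_hull K i)) mulrDr.
rewrite big_split/= -mulr_suml w1 mul1r; congr (_ + _).
rewrite -mulmxA mxE; apply: eq_bigr => i _.
by rewrite -row_mul [in RHS]mxE.
Qed.

Lemma row_translate S i (z : 'rV[int]_d) :
  row i (translate S z) = row i S + map_mx intr z.
Proof. by rewrite rowK. Qed.

Lemma periodic_row_translate v S i (z : 'rV[int]_d) : Defs.periodic v ->
  v (row i (translate S z)) = v (row i S).
Proof. by move=> pv; rewrite row_translate pv. Qed.

Lemma hull_translate S (z : 'rV[int]_d) x :
  hull S x -> hull (translate S z) (x + map_mx intr z).
Proof.
move=> [w [w0 wI w1 ->]]; exists w; split => //.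
rewrite !mulmx_sum_row; under [RHS]eq_bigr do rewrite row_translate scalerDr.
by rewrite big_split/= -scaler_suml w1 scale1r.
Qed.

(** Contracting towards vertex [i] by the factor [t] multiplies the other barycentric coordinates by
    [t], which leaves at least [1 - t] for [i]. *)
Lemma hull_homothety K i (t : R) (y : 'rV[R]_d) : 0 <= t <= 1 -> hull K y ->
  exists w : 'rV[R]_d.+1,
    [/\ forall k, 0 <= w ord0 k, \sum_k w ord0 k = 1, 1 - t <= w ord0 i
      & row i K + t *: (y - row i K) = w *m K].
Proof.
move=> /andP[t0 t1] [w [w0 _ w1 ->]].
exists ((1 - t) *: delta_mx ord0 i + t *: w); split.
- by move=> k; rewrite !mxE addr_ge0// mulr_ge0// subr_ge0.
- under eq_bigr do rewrite !mxE.
  rewrite big_split/= -!mulr_sumr w1 mulr1 (bigD1 i)//= big1 ?eqxx.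
    by rewrite addr0 mulr1 subrK.
  by move=> j /negPf ->.
- by rewrite !mxE !eqxx mulr1 lerDl mulr_ge0.
- by rewrite mulmxDl -!scalemxAl -rowE scalerBr scalerBl scale1r addrA addrAC.
Qed.

(* The sign and ratio conditions on [a] and [b] make the boxes at scales
   [t = 2^-k] pairwise disjoint and keep them on one side of the vertex in each
   coordinate, so that a single integer translate puts all of them inside the
   unit cube. *)
Lemma vertex_boxes S i : Defs.nondegenerate S ->
  exists (z : 'rV[int]_d) (a b : 'I_d -> R),
    let K := translate S z in
    [/\ forall j, a j < b j,
        forall j, 0 < a j /\ b j < 2 * a j \/ b j < 0 /\ 2 * b j < a j
      & forall (t : R) (x : 'rV[R]_d), 0 < t <= 1 ->
        (forall j, t * a j <= x ord0 j - row i K ord0 j <= t * b j) ->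
        (forall j, 0 <= x ord0 j <= 1) /\
        exists w : 'rV[R]_d.+1,
          [/\ forall k, 0 <= w ord0 k, \sum_k w ord0 k = 1, 1 - t <= w ord0 i
            & x = w *m K]].
Proof.
move=> /hull_interior_box[c [r r0 cr]].
pose p := row i S; pose D j := c ord0 j - p ord0 j.
(* The translate puts the vertex coordinate [P j] in [[0, 1)] if the boxes extend upwards and in
   [(0, 1]] if they extend downwards. Hence the room [s j] up to the opposite wall of the cube is
   positive. *)
pose zf j : int :=
  if 0 <= D j then - Num.floor (p ord0 j) else 1 - Num.ceil (p ord0 j).
pose z : 'rV[int]_d := \row_j zf j.
pose P j : R := p ord0 j + (zf j)%:~R.
pose s j := if 0 <= D j then 1 - P j else P j.
have [t0 [t00 t01 t0s]] : exists t0, [/\ 0 < t0, t0 <= 1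
    & forall j, t0 * (`|D j| + r) <= s j].
  have [||t1 t10 t1s] := @fin_uniform_gt0 R _ (fun j t1 => t1 * (`|D j| + r) <= s j).
  - move=> j t t' t'0 tt'; apply: le_trans.
    by rewrite ler_wpM2r// addr_ge0// ltW.
  - move=> j.
    have s0 : 0 < s j.
      rewrite /s /P /zf; case: (leP 0 (D j)) => _.
        by rewrite intrN subr_gt0 ltrBlDl -intrD1 floorD1_gt.
      rewrite intrD intrN; have := ceilB1_lt (p ord0 j).
      by rewrite intrD intrN; lra.
    have Dr : 0 < `|D j| + r by rewrite ltr_wpDl.
    by exists (s j / (`|D j| + r)); [rewrite divr_gt0|rewrite divfK ?gt_eqF].
  - exists (Num.min 1 t1); split; first by rewrite lt_min ltr01.
      by rewrite ge_min lexx.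
    move=> j; apply: le_trans (t1s j).
    by rewrite ler_wpM2r ?addr_ge0 ?(ltW r0)// ge_min lexx orbT.
(* This is the outermost sixth of [[D j - r, D j + r]] on the side away from the vertex. It avoids
   [0] even when [D j = 0], and its endpoints have ratio below 2 in absolute value. *)
pose a' j := if 0 <= D j then D j + 2 / 3 * r else D j - r.
pose b' j := if 0 <= D j then D j + r else D j - 2 / 3 * r.
exists z, (fun j => t0 * a' j), (fun j => t0 * b' j) => /=; split.
- by move=> j; rewrite ltr_pM2l// /a' /b'; case: ifP => _; lra.
- move=> j; rewrite /a' /b'; case: (leP 0 (D j)) => Dj; [left|right].
    by split; nra.
  by split; nra.
move=> t x /andP[tp t1] xab.
have PE j : row i (translate S z) ord0 j = P j.
  by rewrite row_translate /P mxE; congr (_ + _); rewrite !mxE.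
have tt0 : 0 < t * t0 by rewrite mulr_gt0.
have {}xab j : t * t0 * a' j <= x ord0 j - P j <= t * t0 * b' j.
  by have := xab j; rewrite PE !mulrA.
split.
  move=> j; have h1 := t0s j; have := xab j.
  rewrite /a' /b'; move: h1; rewrite /s /P /zf.
  have fl := floor_le (p ord0 j); have ce := ceil_ge (p ord0 j).
  case: (leP 0 (D j)) => Dj.
    rewrite ger0_norm// intrN => h /andP[h3 h4].
    have : t * t0 * (D j + r) <= t0 * (D j + r).
      by rewrite ler_wpM2r// ?ger_pMl//; lra.
    have : 0 <= t * t0 * (D j + 2 / 3 * r) by rewrite mulr_ge0 1?ltW//; lra.
    lra.
  rewrite ltr0_norm// intrD intrN => h /andP[h3 h4].
  have : t * t0 * (- D j + r) <= t0 * (- D j + r).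
    by rewrite ler_wpM2r// ?ger_pMl//; lra.
  have : t * t0 * (D j - 2 / 3 * r) <= 0 by rewrite pmulr_rle0//; lra.
  lra.
(* Undoing the homothety of ratio [t * t0] sends [x] to a point [y] of the box around [c], hence of
   the simplex. *)
pose y := p + (t * t0)^-1 *: (x - row i (translate S z)).
have yE : x = row i (translate S z) +
    (t * t0) *: (y + map_mx intr z - row i (translate S z)).
  rewrite [in X in _ *: X]row_translate -/p opprD addrACA subrr addr0.
  by rewrite /y addrAC subrr add0r scalerA divff ?gt_eqF// scale1r addrC subrK.
have hy : hull S y.
  apply: cr => j.
  have -> : y ord0 j = p ord0 j + (t * t0)^-1 * (x ord0 j - P j).
    rewrite /y mxE; congr (_ + _); rewrite mxE; congr (_ * _).
    by rewrite mxE; congr (_ + _); rewrite mxE PE.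
  have -> : p ord0 j + (t * t0)^-1 * (x ord0 j - P j) - c ord0 j =
    (t * t0)^-1 * (x ord0 j - P j) - D j by rewrite /D; lra.
  have : a' j <= (t * t0)^-1 * (x ord0 j - P j) <= b' j.
    by rewrite mulrC ler_pdivlMr// ler_pdivrMr// ![_ * (t * t0)]mulrC.
  rewrite /a' /b' ler_norml; case: (leP 0 (D j)) => Dj; lra.
have [|w [w0 w1 wi wE]] := @hull_homothety _ i (t * t0) _ _ (hull_translate z hy).
  by rewrite ltW//= -[1]mulr1 ler_pM// ltW.
exists w; split => //; last by rewrite -wE.
by apply: le_trans wi; rewrite lerD2l lerN2 ger_pMr.
Qed.

End Simplex.

(** * The lower bound for exponents [q >= d] *)

Section LowerBound.
Variables (R : realType) (d : nat) (T : periodic_mesh R d).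
Hypothesis d_gt0 : (0 < d)%N.
Implicit Types (S : 'M[R]_(d.+1, d)) (v : 'rV[R]_d -> R).

Lemma mesh_nondegenerate S : S \in simplices T -> Defs.nondegenerate S.
Proof. by case: T => s nd cov conf /= Ss; exact: nd. Qed.

Lemma measurable_unit_cube : measurable (@unit_cube R d).
Proof. exact: (measurable_box (fun=> 0) (fun=> 1)). Qed.

(** Sums the contributions of disjoint boxes at dyadic scales near a vertex. A single box will bound
    vertex values from above, many boxes will bound them from below. *)
Lemma vertex_le_torus_integral S i : S \in simplices T ->
  exists (z : 'rV[int]_d), exists2 V : R, 0 < V &
    forall (f : 'rV[R]_d -> R) N (c : 'I_N -> R),
    (forall x, 0 <= f x) -> (forall k, 0 <= c k) ->
    (forall (k : 'I_N) (w : 'rV[R]_d.+1), (forall l, 0 <= w ord0 l) ->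
       \sum_l w ord0 l = 1 -> 1 - 2^-1 ^+ k.+1 <= w ord0 i ->
       c k <= f (w *m translate S z)) ->
    ((\sum_(k < N) c k * ((2^-1 ^+ k.+1) ^+ d * V))%:E <= torus_integral f)%E.
Proof.
move=> ST; have [z [a [b [ab absg abP]]]] := vertex_boxes i (mesh_nondegenerate ST).
exists z, (\prod_j (b j - a j)); first by apply: prodr_gt0 => j _; rewrite subr_gt0.
move=> f N c f0 c0 fc.
pose t (k : nat) : R := 2^-1 ^+ k.+1.
have t0 k : 0 < t k by rewrite exprn_gt0// invr_gt0.
have t01 k : 0 < t k <= 1 by rewrite t0 exprn_ile1// invf_le1// ler1n.
have tS k l : (k < l)%N -> t l <= t k / 2.
  move=> kl; rewrite /t -exprSr ler_wiXn2l ?ltnS// ?invr_ge0//.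
  by rewrite invf_le1// ler1n.
pose p := row i (translate S z).
pose A (k : 'I_N) j := p ord0 j + t k * a j.
pose B (k : 'I_N) j := p ord0 j + t k * b j.
have AB k j : A k j <= B k j by rewrite lerD2l ler_pM2l// ltW.
have boxP k (x : d.-tuple (measurableTypeR R)) : box (A k) (B k) x ->
    @unit_cube R d x /\ c k <= f (\row_j tnth x j).
  move=> xb; have [|x01 [w [w0 w1 wi wE]]] := abP _ (\row_j tnth x j) (t01 k).
    by move=> j; have := xb j; rewrite /A /B !mxE -/p lerBrDl lerBlDl.
  split; first by move=> j; have := x01 j; rewrite mxE.
  by rewrite wE; exact: fc.
have -> : \sum_(k < N) c k * ((2^-1 ^+ k.+1) ^+ d * \prod_j (b j - a j)) =
    \sum_(k < N) c k * \prod_j (B k j - A k j).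
  apply: eq_bigr => k _; congr (_ * _).
  have -> : (2^-1 ^+ k.+1) ^+ d = \prod_(j < d) t k by rewrite prodr_const card_ord.
  rewrite -big_split/=; apply: eq_bigr => j _.
  by rewrite /A /B opprD addrACA subrr add0r mulrBr.
apply: sum_boxes_le_integral => //.
- exact: measurable_unit_cube.
- by move=> k x /boxP[].
- by move=> k x /boxP[].
(* One coordinate separates two scales: if [a j > 0] then [t l * b j < 2 * t l * a j <= t k * a j],
   and symmetrically if [b j < 0]. *)
suff disj (k l : 'I_N) x : (k < l)%N -> box (A k) (B k) x -> box (A l) (B l) x -> False.
  move=> k l x kx lx; have [kl|lk|/val_inj//] := ltngtP k l.
    by have := disj _ _ _ kl kx lx.
  by have := disj _ _ _ lk lx kx.
move=> kl /(_ (Ordinal d_gt0)) + /(_ (Ordinal d_gt0)); rewrite /A /B.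
set j := Ordinal d_gt0; have := t0 l; have := t0 k; have := tS _ _ kl.
move: (t k) (t l) (tnth x j) (p ord0 j) => tk tl y q tlk tk0 tl0.
case: (absg j) (ab j) => -[h1 h2] h3 /andP[h4 h5] /andP[h6 h7]; nra.
Qed.

(** At scale [1/2] the vertex has weight at least [1/2], and the other vertex values are positive,
    so [v >= v (row i S) / 2] there. Writing the bound as [c^-1] makes it stable under shrinking
    [c], as [fin_uniform_gt0] requires. *)
Lemma vertex_le_of_integral S i C0 : S \in simplices T -> 0 < C0 ->
  exists2 c : R, 0 < c & forall v, Vh T v -> (forall x, 0 < v x) ->
    (torus_integral v <= C0%:E)%E -> v (row i S) <= c^-1.
Proof.
move=> ST C00; have [z [V V0 VP]] := vertex_le_torus_integral i ST.
pose W := 2^-1 ^+ d * V / 2.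
have W0 : 0 < W by rewrite !mulr_gt0 ?exprn_gt0 ?invr_gt0.
exists (W / C0); first by rewrite divr_gt0.
move=> v [_ vper vaff] v0 intv; rewrite invf_div ler_pdivlMr//.
rewrite -lee_fin; apply: le_trans intv.
have := VP v 1 (fun=> v (row i S) / 2); rewrite big_ord1 expr1.
have -> : v (row i S) / 2 * (2^-1 ^+ d * V) = v (row i S) * W by rewrite /W; ring.
apply=> [x|_|k w w0 w1]; [exact: ltW|by rewrite divr_ge0// ltW|].
rewrite ord1 /= expr1 (affine_on_hullE (vaff _ _ ST))// => wi.
rewrite (bigD1 i)//= periodic_row_translate// -[leLHS]addr0 lerD//.
  by rewrite mulrC ler_wpM2r ?(ltW (v0 _))//; lra.
by apply: sumr_ge0 => l _; rewrite mulr_ge0// ltW.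
Qed.

Lemma vertex_ge_of_integral S i (q C0 M : R) : S \in simplices T ->
  d%:R <= q -> 0 < C0 -> 0 < M ->
  exists2 c : R, 0 < c & forall v, Vh T v -> (forall x, 0 < v x) ->
    (forall k, v (row k S) <= M) ->
    (torus_integral (fun x => v x `^ (- q))%R <= C0%:E)%E -> c <= v (row i S).
Proof.
move=> ST dq C00 M0; have [z [V V0 VP]] := vertex_le_torus_integral i ST.
pose kappa := (1 + M) `^ (- q) * V.
have kappa0 : 0 < kappa by rewrite mulr_gt0// powR_gt0// addr_gt0.
(* Each scale will contribute at least [kappa]; this many scales exceed [C0]. *)
pose N := (Num.truncn (C0 / kappa)).+1.
exists (2^-1 ^+ N); first by rewrite exprn_gt0// invr_gt0.
move=> v [_ vper vaff] v0 vM intv; rewrite leNgt; apply/negP => vlt.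
pose t (k : nat) : R := 2^-1 ^+ k.+1.
have t0 k : 0 < t k by rewrite exprn_gt0// invr_gt0.
have q0 : 0 <= q by apply: le_trans dq; rewrite ler0n.
have : ((\sum_(k < N) ((1 + M) * t k) `^ (- q) * (t k ^+ d * V))%:E <=
    torus_integral (fun x => v x `^ (- q))%R)%E.
  apply: VP => [x|k|k w w0 w1 wi]; [exact: powR_ge0|exact: powR_ge0|].
  have tM0 : 0 < (1 + M) * t k by rewrite mulr_gt0// addr_gt0.
  rewrite !powRN lef_pV2 ?posrE ?powR_gt0//.
  apply: ge0_ler_powR; rewrite ?nnegrE ?(ltW (v0 _)) ?(ltW tM0)//.
  rewrite (affine_on_hullE (vaff _ _ ST))// (bigD1 i)//= periodic_row_translate//.
  have wi1 : w ord0 i <= 1.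
    by rewrite -w1 (bigD1 i)//= lerDl sumr_ge0.
  (* The weights off vertex [i] sum to at most [t k], so [v <= v (row i S) + t k * M]; as
     [v (row i S) < 2^-1 ^+ N <= t k], this is at most [(1 + M) * t k]. *)
  apply: (@le_trans _ _ (v (row i S) + (1 - w ord0 i) * M)).
    rewrite lerD//; first by rewrite ger_pMl.
    have -> : 1 - w ord0 i = \sum_(l | l != i) w ord0 l.
      by rewrite -w1 (bigD1 i)//= addrAC subrr add0r.
    rewrite mulr_suml; apply: ler_sum => l _.
    by rewrite periodic_row_translate// ler_wpM2l.
  have : 2^-1 ^+ N <= t k.
    by rewrite ler_wiXn2l ?invr_ge0 ?invf_le1 ?ler1n//; exact: ltn_ord.
  move=> Nt; rewrite [(1 + M) * _]mulrDl mul1r [M * t k]mulrC lerD//; first exact: ltW (lt_le_trans vlt Nt).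
  by rewrite ler_wpM2r ?(ltW M0)// lerBlDr addrC -lerBlDr.
apply/negP; rewrite -ltNge; apply: le_lt_trans intv _.
rewrite lte_fin; apply: (@lt_le_trans _ _ (N%:R * kappa)).
  by rewrite -ltr_pdivrMr// truncnS_gt.
rewrite mulr_natl -[X in _ *+ X]card_ord -sumr_const; apply: ler_sum => k _.
rewrite powRM ?(ltW (t0 k))//; last by rewrite addr_ge0// ltW.
rewrite /kappa -mulrA ler_wpM2l ?powR_ge0// mulrA -[leLHS]mul1r ler_wpM2r ?(ltW V0)//.
rewrite -/(t k) -powR_mulrn ?(ltW (t0 k))// -powRD; last by apply/implyP => _; rewrite gt_eqF.
have tk1 : 0 < t k <= 1 by rewrite t0 exprn_ile1// invf_le1// ler1n.
(* Here [d <= q] enters: a power of [t k <= 1] with nonpositive exponent [d - q] is at least [1], so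
   small scales count as much as large ones. *)
apply: (@le_trans _ _ (t k `^ 0)); first by rewrite powRr0.
by apply: (ger_powR tk1); rewrite addrC subr_le0.
Qed.

(** The common upper bound [m^-1] on vertex values comes first, because the lower bound at one
    vertex depends on it. Any other value of [v] is a convex combination of vertex values. *)
Lemma has_lower_bound_ge_dim (q C0 : R) : d%:R <= q -> 0 < C0 ->
  has_lower_bound T q C0.
Proof.
move=> dq C00.
have [|S ST|m m0 mP] := @seq_uniform_gt0 R _ (simplices T)
  (fun S c => forall v, Vh T v -> (forall x, 0 < v x) ->
    (torus_integral v <= C0%:E)%E -> forall i, v (row i S) <= c^-1).
- move=> S c c' c'0 cc' h v Tv v0 iv i; apply: le_trans (h v Tv v0 iv i) _.
  by rewrite lef_pV2// posrE// (lt_le_trans c'0).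
- have [||c c0 cP] := @fin_uniform_gt0 R _ (fun (i : 'I_d.+1) c =>
    forall v, Vh T v -> (forall x, 0 < v x) ->
    (torus_integral v <= C0%:E)%E -> v (row i S) <= c^-1).
  + move=> i c c' c'0 cc' h v Tv v0 iv; apply: le_trans (h v Tv v0 iv) _.
    by rewrite lef_pV2// posrE// (lt_le_trans c'0).
  + by move=> i; exact: vertex_le_of_integral.
  + by exists c => // v Tv v0 iv i; exact: cP.
have [|S ST|c c0 cP] := @seq_uniform_gt0 R _ (simplices T)
  (fun S c => forall v, Vh T v -> (forall x, 0 < v x) ->
    (torus_integral v <= C0%:E)%E ->
    (torus_integral (fun x => v x `^ (- q))%R <= C0%:E)%E ->
    forall i, c <= v (row i S)).
- move=> S c c' c'0 cc' h v Tv v0 iv ivq i; exact: le_trans (h v Tv v0 iv ivq i).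
- have [||c c0 cP] := @fin_uniform_gt0 R _ (fun (i : 'I_d.+1) c =>
    forall v, Vh T v -> (forall x, 0 < v x) ->
    (torus_integral v <= C0%:E)%E ->
    (torus_integral (fun x => v x `^ (- q))%R <= C0%:E)%E ->
    c <= v (row i S)).
  + move=> i c c' c'0 cc' h v Tv v0 iv ivq; exact: le_trans (h v Tv v0 iv ivq).
  + move=> i; have m'0 : 0 < m^-1 by rewrite invr_gt0.
    have [c c0 cP] := vertex_ge_of_integral i ST dq C00 m'0.
    by exists c => // v Tv v0 iv ivq; apply: cP => // k; exact: mP.
  + by exists c => // v Tv v0 iv ivq i; exact: cP.
exists c => // v Tv v0 ivq.
have [iv0 ivq0] : (0 <= torus_integral v /\
    0 <= torus_integral (fun x => v x `^ (- q))%R)%E.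
  split; rewrite /torus_integral lebesgue_tupleE; apply: integral_ge0 => x _.
    by rewrite lee_fin ltW.
  by rewrite lee_fin powR_ge0.
have iv : (torus_integral v <= C0%:E)%E by apply: le_trans ivq; rewrite leeDl.
have ivq' : (torus_integral (fun x => v x `^ (- q))%R <= C0%:E)%E.
  by apply: le_trans ivq; rewrite leeDr.
apply: lb_le_inf; first by exists (v 0), 0.
move=> _ [x _ <-].
have [S [z [ST [w [w0 _ w1 ->]]]]] : exists S (z : 'rV[int]_d),
    S \in simplices T /\ hull (translate S z) x.
  by case: T => s nd cov conf; exact: cov.
have [_ vper vaff] := Tv.
rewrite (affine_on_hullE (vaff _ _ ST))// -[c]mul1r -w1 mulr_suml.
apply: ler_sum => i _; rewrite periodic_row_translate// ler_wpM2l//.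
exact: (cP S ST v Tv v0 iv ivq').
Qed.

End LowerBound.

(** * The Freudenthal triangulation of mesh size 1/2 *)

(** [s j] is the position of [j] when the values of [r] are sorted decreasingly. It will select the
    simplex containing a given point. *)
Lemma sorting_perm (R : realType) (d : nat) (r : 'I_d -> R) :
  exists s : {perm 'I_d}, forall j l, (s j < s l)%N -> r l <= r j.
Proof.
pose leT (i j : 'I_d) := r j <= r i.
have tot : total leT by move=> i j; exact: le_total.
have tr : transitive leT by move=> i j k ji kj; exact: le_trans kj ji.
pose o := sort leT (enum 'I_d).
have io i : i \in o by rewrite mem_sort mem_enum.
have idx i : (index i o < d)%N.
  by have := io i; rewrite -index_mem size_sort size_enum_ord.
pose f i := Ordinal (idx i).
have finj : injective f.
  move=> i j /(congr1 val) /= ij.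
  exact: (index_inj i (io i) (io j) ij).
exists (perm finj) => j l; rewrite !permE /= => jl.
exact: (sorted_ltn_index tr (sort_sorted tot _) j l (io j) (io l) jl).
Qed.

Section Freudenthal.
Variables (R : realType) (d : nat).
Implicit Types (s : {perm 'I_d}) (beta : 'rV[int]_d) (w x : 'rV[R]_d.+1).

(* The [k]-th vertex is reached from [beta / 2] by [k] half-unit steps, in the
   directions [j] with [s j = 0, 1, ..., k - 1]. *)
Definition kuhn s beta : 'M[R]_(d.+1, d) :=
  \matrix_(k < d.+1, j < d) (((beta ord0 j)%:~R + (s j < k)%N%:R) / 2).

Lemma translate_kuhn s beta (z : 'rV[int]_d) :
  translate (kuhn s beta) z = kuhn s (beta + z *+ 2).
Proof.
by apply/matrixP => k j; rewrite mulr2n !mxE !intrD; field.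
Qed.

(** Vertex [k] has made the step in direction [j] exactly when [s j < k], so coordinates are
    governed by tail sums of the weights. *)
Lemma kuhn_comb s beta w : \sum_k w ord0 k = 1 -> forall j,
  (w *m kuhn s beta) ord0 j =
    ((beta ord0 j)%:~R + \sum_(k < d.+1 | (s j < k)%N) w ord0 k) / 2.
Proof.
move=> w1 j; rewrite mxE; under eq_bigr do rewrite mxE mulrA.
rewrite -mulr_suml; congr (_ / _); under eq_bigr do rewrite mulrDr.
rewrite big_split/= -mulr_suml w1 mul1r; congr (_ + _).
rewrite [RHS]big_mkcond; apply: eq_bigr => k _.
by case: ifP => _; rewrite ?mulr1 ?mulr0.
Qed.

Lemma kuhn_nondegenerate s beta : Defs.nondegenerate (kuhn s beta).
Proof.
apply: inj_row_free => v /rowP v0.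
(* Column [s^-1 m] of the edge matrix is [1/2] on the rows [i >= m] and zero elsewhere, so a
   vanishing combination has vanishing tail sums. Consecutive tails differ by one coefficient. *)
have tail (m : nat) : \sum_(i < d | (m <= i)%N) v ord0 i = 0.
  have [dm|md] := leqP d m.
    by rewrite big_pred0// => i; apply/negbTE; rewrite -ltnNge (leq_trans _ dm).
  have := v0 (s^-1 (Ordinal md))%g; rewrite !mxE => vm.
  apply: (@mulIf _ (2^-1)); first by rewrite invr_eq0.
  rewrite mul0r -{}[RHS]vm mulr_suml big_mkcond; apply: eq_bigr => i _.
  rewrite !mxE permKV /= /bump /= add1n ltnS.
  rewrite (_ : v 0 i = v ord0 i); last by congr (v _ _); exact: val_inj.
  by case: (m <= i)%N => /=; field.
apply/rowP => m; rewrite mxE; have := tail m; rewrite (bigD1 m)//=.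
rewrite (eq_bigl (fun i : 'I_d => (m.+1 <= i)%N)); first by rewrite tail addr0.
by move=> i; rewrite ltn_neqAle andbC eq_sym.
Qed.

Lemma tail_weight_le w (P Q : pred 'I_d.+1) : (forall k, 0 <= w ord0 k) ->
  subpred P Q -> \sum_(k | P k) w ord0 k <= \sum_(k | Q k) w ord0 k.
Proof.
move=> w0 PQ; rewrite big_mkcond [leRHS]big_mkcond; apply: ler_sum => k _.
by case: ifPn => [/PQ ->//|_]; case: ifP.
Qed.

(* The points [floor (2 * x + theta) / 2] with [0 <= theta < 1] are the vertices
   of the smallest face containing [x]; they do not depend on the simplex. *)
Lemma kuhn_vertex_floor s beta w i : (forall k, 0 <= w ord0 k) ->
  \sum_k w ord0 k = 1 -> 0 < w ord0 i ->
  exists2 theta : R, 0 <= theta < 1 & forall j,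
    kuhn s beta i j =
      (Num.floor (2 * (w *m kuhn s beta) ord0 j + theta))%:~R / 2.
Proof.
move=> w0 w1 wi.
pose S := \sum_(k < d.+1 | (i <= k)%N) w ord0 k.
have Si : S = w ord0 i + \sum_(k < d.+1 | (i < k)%N) w ord0 k.
  rewrite /S (bigD1 i)//=; congr (_ + _); apply: eq_bigl => k.
  by rewrite ltn_neqAle andbC eq_sym.
have S0 : 0 < S by rewrite Si ltr_pwDl// sumr_ge0.
have S1 : S <= 1 by rewrite -w1; exact: tail_weight_le.
(* With this shift, coordinate [j] rounds up exactly when its tail sum [sj] reaches [S]. That
   happens if [s j < i]; otherwise [sj <= S - w ord0 i < S]. *)
exists (1 - S); first by lra.
move=> j; rewrite mxE kuhn_comb// [2 * _]mulrC divfK//; congr (_ / _).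
set sj := \sum_(k | _) _.
have sj0 : 0 <= sj by rewrite sumr_ge0.
have sj1 : sj <= 1 by rewrite -w1; exact: tail_weight_le.
rewrite (@floor_def _ _ (beta ord0 j + (s j < i)%N)); first by rewrite intrD.
rewrite !intrD; case: (ltnP (s j) i) => h.
  have : S <= sj by apply: tail_weight_le => // k; exact: leq_trans.
  by move=> ?; rewrite /=; lra.
have : sj <= \sum_(k < d.+1 | (i < k)%N) w ord0 k.
  by apply: tail_weight_le => // k; exact: leq_ltn_trans.
by rewrite /= => ?; lra.
Qed.

(** Converse of [kuhn_vertex_floor]: tail sums decrease along the order [s], so the coordinates
    rounding up form an initial segment of it, which is what a vertex encodes. *)
Lemma floor_kuhn_vertex s beta w (theta : R) : (forall k, 0 <= w ord0 k) ->
  \sum_k w ord0 k = 1 -> 0 <= theta < 1 ->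
  exists i, forall j, kuhn s beta i j =
      (Num.floor (2 * (w *m kuhn s beta) ord0 j + theta))%:~R / 2.
Proof.
move=> w0 w1 t01.
pose S (m : nat) := \sum_(k < d.+1 | (m <= k)%N) w ord0 k.
have P0 : 1 <= S (@ord0 d) + theta.
  by rewrite /S /= w1; lra.
(* [i] is the last index whose tail sum plus [theta] reaches [1]; index [0] qualifies because all
   weights sum to [1]. *)
have [i Pi imax] := @arg_maxnP _ (@ord0 d) (fun m => 1 <= S m + theta) val P0.
exists i => j; rewrite mxE kuhn_comb// [2 * _]mulrC divfK//; congr (_ / _).
set sj := \sum_(k | _) _.
have sj0 : 0 <= sj by rewrite sumr_ge0.
have sj1 : sj <= 1 by rewrite -w1; exact: tail_weight_le.
rewrite (@floor_def _ _ (beta ord0 j + (s j < i)%N)); first by rewrite intrD.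
rewrite !intrD; case: (ltnP (s j) i) => h.
  have : S i <= sj by apply: tail_weight_le => // k; exact: leq_trans.
  by rewrite /=; lra.
have : ~~ (1 <= S (lift ord0 (s j)) + theta).
  apply/negP => /imax /=; rewrite /bump /= add1n => h2.
  by have := leq_trans h2 h; rewrite ltnn.
rewrite -ltNge /S /= /bump /= add1n -/sj => ?.
by rewrite /=; lra.
Qed.

(** A vertex of [K1] carrying weight at a common point is recovered from that point and some [theta]
    by rounding, hence is a vertex of [K2] too. Conversely, weights on shared vertices transfer to
    [K2]. *)
Lemma kuhn_conforming s1 beta1 s2 beta2 :
  let K1 := kuhn s1 beta1 in let K2 := kuhn s2 beta2 in
  hull K1 `&` hull K2 = face K1 [set i | [exists k, row i K1 == row k K2]]%SET.
Proof.
move=> K1 K2; apply/seteqP; split=> x.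
  move=> [[w [w0 _ w1 xw]] [u [u0 _ u1 xu]]]; exists w; split => // i.
  rewrite inE => /existsPn nex; apply/eqP; apply: contraT => wi.
  have [|th th01 wE] := kuhn_vertex_floor s1 beta1 w0 w1 (i := i).
    by rewrite lt_def wi w0.
  have [k uE] := floor_kuhn_vertex s2 beta2 u0 u1 th01.
  have E : w *m K1 = u *m K2 by rewrite -xw.
  by have /eqP[] := nex k; apply/rowP => j; rewrite [LHS]mxE [RHS]mxE wE -/K1 E uE.
move=> [w [w0 wI w1 xw]]; split; first by exists w; split => // i; rewrite inE.
(* The default [ord0] is reached only at vertices of weight zero. *)
pose f i := odflt ord0 [pick k | row i K1 == row k K2].
have fP i : w ord0 i != 0 -> row i K1 = row (f i) K2.
  move=> wi; rewrite /f; case: pickP => [k /eqP//|nex].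
  move: wi; rewrite wI ?eqxx// inE; apply/existsPn => k; by rewrite nex.
exists (\sum_i w ord0 i *: delta_mx ord0 (f i)); split.
- move=> k; rewrite summxE; apply: sumr_ge0 => i _.
  by rewrite !mxE mulr_ge0// ler0n.
- by move=> i; rewrite inE.
- under eq_bigr do rewrite summxE; rewrite exchange_big/= -[RHS]w1.
  apply: eq_bigr => i _; rewrite (bigD1 (f i))//= big1 ?addr0 ?mxE ?eqxx ?mxE ?eqxx ?mulr1//.
  by move=> k /negPf kf; rewrite !mxE kf andbF mulr0.
rewrite xw mulmx_sum_row mulmx_suml; apply: eq_bigr => i _.
rewrite -scalemxAl -rowE; have [->|/fP ->//] := eqVneq (w ord0 i) 0.
by rewrite !scale0r.
Qed.

(** The integer parts of [2 * x] give [beta]; sorting the fractional parts gives [s], and successive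
    gaps of the sorted list are the barycentric weights. *)
Lemma kuhn_cover (x : 'rV[R]_d) : exists s beta, hull (kuhn s beta) x.
Proof.
pose beta : 'rV[int]_d := \row_j Num.floor (2 * x ord0 j).
pose r j : R := 2 * x ord0 j - (beta ord0 j)%:~R.
have r01 j : 0 <= r j <= 1.
  rewrite /r mxE subr_ge0 floor_le/= lerBlDl ltW//.
  by have := floorD1_gt (2 * x ord0 j); rewrite intrD.
have [s sP] := sorting_perm r.
(* [S] lists [1], then the sorted fractional parts, then [0]: at index [d.+1] the [insub] fails and
   yields the default. *)
pose S (m : nat) : R :=
  if m is m'.+1 then oapp (fun i => r (s^-1%g i)) 0 (insub m') else 1.
have Sd : S d.+1 = 0 by rewrite /S insubF// ltnn.
have Ss j : S (s j).+1 = r j by rewrite /S valK /= permK.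
have Sdec m : (m <= d)%N -> S m.+1 <= S m.
  case: m => [|m] md; rewrite /S.
    by case: insubP => [i _ _|_] //=; have /andP[] := r01 (s^-1%g i).
  have [i _ im|_] := insubP _ m.+1; last first.
    by case: insubP => [i _ _|_] //=; have /andP[] := r01 (s^-1%g i).
  have [i' _ im'|] := insubP _ m; last by rewrite md.
  by rewrite /=; apply: sP; rewrite !permKV im im'.
pose w : 'rV[R]_d.+1 := \row_k (S k - S k.+1).
have tail (m : nat) : (m <= d.+1)%N -> \sum_(k < d.+1 | (m <= k)%N) w ord0 k = S m.
  move=> md; under eq_bigr do rewrite mxE.
  rewrite -(big_geq_mkord _ _ predT (fun k => S k - S k.+1)).
  transitivity (- (S d.+1 - S m)); last by rewrite Sd sub0r opprK.
  rewrite -telescope_sumr// -sumrN.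
  by apply: eq_bigr => k _; rewrite opprB.
have w1 : \sum_k w ord0 k = 1 by rewrite -[RHS](tail 0%N).
exists s, beta, w; split => //.
- by move=> k; rewrite mxE subr_ge0 Sdec// -ltnS.
- by move=> k; rewrite inE.
apply/rowP => j; rewrite kuhn_comb// (tail (s j).+1) ?Ss; last first.
  by rewrite ltnS ltnW.
by rewrite /r addrC subrK mulrC mulKf.
Qed.

(** Translating by [z] adds [2 z] to [beta], so offsets in [{0, 1}^d] represent all classes modulo
    integer vectors. *)
Definition freudenthal : seq 'M[R]_(d.+1, d) :=
  [seq kuhn u.1 (\row_j (u.2 ord0 j)%:Z) | u : {perm 'I_d} * 'rV[bool]_d].

Lemma freudenthal_mem_translate (s : {perm 'I_d}) (beta : 'rV[int]_d) :
  exists S z, S \in freudenthal /\ kuhn s beta = translate S z.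
Proof.
pose b : 'rV[bool]_d := \row_j ((beta ord0 j %% 2)%Z == 1).
exists (kuhn s (\row_j (b ord0 j)%:Z)), (\row_j (beta ord0 j %/ 2)%Z); split.
  by rewrite /freudenthal; apply/fintype.imageP; exists (s, b).
rewrite translate_kuhn; congr kuhn; apply/rowP => j.
rewrite mulr2n !mxE [LHS](divz_eq _ 2).
have := modz_ge0 (beta ord0 j) (isT : 2 != 0 :> int).
have := ltz_mod (beta ord0 j) (isT : 2 != 0 :> int).
by case: (_ %% _)%Z => [[|[|]]|] //= _ _; lia.
Qed.

Lemma freudenthal_translate S (z : 'rV[int]_d) : S \in freudenthal ->
  exists s beta, translate S z = kuhn s beta.
Proof.
by rewrite /freudenthal => /fintype.imageP[u _ ->]; exists u.1; rewrite translate_kuhn; eexists.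
Qed.

Definition freudenthal_mesh : periodic_mesh R d.
Proof.
exists freudenthal.
- by rewrite /freudenthal => S /fintype.imageP[u _ ->]; exact: kuhn_nondegenerate.
- move=> x; have [s [beta xs]] := kuhn_cover x.
  have [S [z [ST E]]] := freudenthal_mem_translate s beta.
  by exists S, z; rewrite -E.
- move=> S1 S2 z1 z2 /freudenthal_translate-/(_ z1)[s1 [b1 ->]].
  move=> /freudenthal_translate-/(_ z2)[s2 [b2 ->]] /=.
  eexists; eexists; split; first exact: kuhn_conforming.
  by rewrite setIC; exact: kuhn_conforming.
Defined.

End Freudenthal.

(** * Distance to the nearest integer *)

Section DistanceToIntegers.
Variable R : realType.
Implicit Types (t : R) (n : int).

Definition dist_int t : R := `|t - (Num.floor (t + 2^-1))%:~R|.

Lemma dist_int_ge0 t : 0 <= dist_int t. Proof. exact: normr_ge0. Qed.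

Lemma dist_int_le t n : dist_int t <= `|t - n%:~R|.
Proof.
rewrite /dist_int; set m := Num.floor _.
have h1 : m%:~R <= t + 2^-1 by exact: floor_le.
have h2 : t + 2^-1 < m%:~R + 1 by rewrite -intrD1 floorD1_gt.
have [nm|mn|->//] := ltgtP n m.
  have : n%:~R + 1 <= m%:~R :> R by rewrite -intrD1 ler_int; lia.
  move=> h3; rewrite ler_norml; have := ler_norm (t - n%:~R); lra.
have : m%:~R + 1 <= n%:~R :> R by rewrite -intrD1 ler_int; lia.
move=> h3; rewrite ler_norml; have := ler_norm (- (t - n%:~R)); rewrite normrN; lra.
Qed.

Lemma dist_int_attained t : exists n, dist_int t = `|t - n%:~R|.
Proof. by exists (Num.floor (t + 2^-1)). Qed.

Lemma dist_int_lipschitz s t : `|dist_int s - dist_int t| <= `|s - t|.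
Proof.
have h (a b : R) : dist_int a - dist_int b <= `|a - b|.
  have [n ->] := dist_int_attained b; rewrite lerBlDr.
  apply: le_trans (dist_int_le a n) _.
  by rewrite -(subrKA b) ler_normD.
by rewrite ler_norml lerNl opprB h distrC h.
Qed.

Lemma dist_intDz t n : dist_int (t + n%:~R) = dist_int t.
Proof.
have h (a : R) m : dist_int (a + m%:~R) <= dist_int a.
  have [k ->] := dist_int_attained a.
  by rewrite (le_trans (dist_int_le _ (k + m)))// intrD opprD addrACA subrr addr0.
by apply/eqP; rewrite eq_le h/= -{1}[t](addrK n%:~R) -intrN h.
Qed.

(** A single integer is nearest to all points of the half interval: [m] if [n = 2 m], giving slope
    1, and [m + 1] if [n = 2 m + 1], giving slope -1. *)
Lemma dist_int_affine n : exists a b : R, forall t,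
  n%:~R / 2 <= t <= (n%:~R + 1) / 2 -> dist_int t = a * t + b.
Proof.
pose m := (n %/ 2)%Z.
have : n = m * 2 \/ n = m * 2 + 1 by rewrite /m; lia.
case=> ->; [exists 1, (- m%:~R)|exists (-1), (m%:~R + 1)] => t;
  rewrite ?intrD intrM => ht.
  apply/eqP; rewrite eq_le; apply/andP; split.
    by apply: le_trans (dist_int_le t m) _; rewrite ler_norml; lra.
  have [k ->] := dist_int_attained t.
  have [km|mk] := leP k m.
    have : k%:~R <= m%:~R :> R by rewrite ler_int.
    by have := ler_norm (t - k%:~R); lra.
  have : m%:~R + 1 <= k%:~R :> R by rewrite -intrD1 ler_int; lia.
  by have := ler_norm (- (t - k%:~R)); rewrite normrN; lra.
apply/eqP; rewrite eq_le; apply/andP; split.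
  by apply: le_trans (dist_int_le t (m + 1)) _; rewrite intrD ler_norml; lra.
have [k ->] := dist_int_attained t.
have [km|mk] := leP k m.
  have : k%:~R <= m%:~R :> R by rewrite ler_int.
  by have := ler_norm (t - k%:~R); lra.
have : m%:~R + 1 <= k%:~R :> R by rewrite -intrD1 ler_int; lia.
by have := ler_norm (- (t - k%:~R)); rewrite normrN; lra.
Qed.

Lemma dist_int_ge t : 0 <= t <= 1 -> Num.min t (1 - t) <= dist_int t.
Proof.
move=> t01; have [k ->] := dist_int_attained t; rewrite ge_min.
have [k0|k0] := leP k 0; apply/orP; [left|right].
  have : k%:~R <= 0 :> R by rewrite -[0]/(0%:~R) ler_int.
  by have := ler_norm (t - k%:~R); lra.
have : 1 <= k%:~R :> R by rewrite -[1]/(1%:~R) ler_int; lia.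
by have := ler_norm (- (t - k%:~R)); rewrite normrN; lra.
Qed.

Lemma dist_int_le1 t : dist_int t <= 1.
Proof.
apply: le_trans (dist_int_le t (Num.floor t)) _.
by have := floor_le t; have := floorD1_gt t; rewrite intrD1 ler_norml; lra.
Qed.

Lemma continuous_dist_int : continuous dist_int.
Proof.
move=> t; apply/cvgrPdist_le => /= e e0; near=> s.
apply: le_trans (dist_int_lipschitz _ _) _.
near: s; apply: cvgr_dist_le => //; exact: cvg_id.
Unshelve. all: by end_near. Qed.

End DistanceToIntegers.

(** * Spike functions in the finite element space *)

Section Spike.
Variables (R : realType) (d : nat).
Implicit Types (eps : R) (x : 'rV[R]_d).

Definition spike (eps : R) (x : 'rV[R]_d) : R :=
  eps + \sum_j dist_int (x ord0 j).

Lemma spike_ge eps x j : eps + dist_int (x ord0 j) <= spike eps x.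
Proof.
rewrite lerD2l (bigD1 j)//= lerDl; apply: sumr_ge0 => i _; exact: dist_int_ge0.
Qed.

Lemma spike_ge_eps eps x : eps <= spike eps x.
Proof. by rewrite lerDl; apply: sumr_ge0 => i _; exact: dist_int_ge0. Qed.

Lemma spike_le eps x : spike eps x <= eps + d%:R.
Proof.
rewrite lerD2l -[X in _ <= X%:R]card_ord -sumr_const.
by apply: ler_sum => j _; exact: dist_int_le1.
Qed.

Lemma spike0 eps : spike eps 0 = eps.
Proof.
rewrite /spike big1 ?addr0// => j _; rewrite mxE; apply/eqP.
rewrite eq_le dist_int_ge0 andbT; apply: le_trans (dist_int_le 0 0) _.
by rewrite subr0 normr0.
Qed.

Lemma continuous_spike eps : continuous (spike eps).
Proof.
have sum_continuous (r : seq 'I_d) :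
    continuous (fun x : 'rV[R]_d => \sum_(j <- r) dist_int (x ord0 j)).
  elim: r => [|j r IH].
    rewrite (_ : (fun _ => _) = cst 0); first exact: cst_continuous.
    by apply/funext => x; rewrite big_nil.
  pose f (x : 'rV[R]_d) : R := dist_int (x ord0 j).
  rewrite (_ : (fun _ => _) = (f : 'rV[R]_d -> R^o) + (fun x : 'rV[R]_d =>
      \sum_(j <- r) dist_int (x ord0 j) : R^o)); last first.
    by apply/funext => x; rewrite big_cons.
  move=> x; apply: continuousD; last exact: IH.
  apply: (@continuous_comp _ _ _ (fun x : 'rV[R]_d => x ord0 j) (@dist_int R)).
    exact: coord_continuous.
  exact: continuous_dist_int.
rewrite (_ : spike eps = (cst eps : 'rV[R]_d -> R^o) + (fun x : 'rV[R]_d =>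
    \sum_j dist_int (x ord0 j) : R^o))//.
by move=> x; apply: continuousD; [exact: cst_continuous|exact: sum_continuous].
Qed.

(** On a Kuhn simplex, coordinate [j] stays between [beta_j / 2] and [(beta_j + 1) / 2], where
    [dist_int] is affine. This is why the mesh size is 1/2. *)
Lemma spike_Vh eps : Vh (freudenthal_mesh R d) (spike eps).
Proof.
split; first exact: continuous_spike.
- move=> x z; rewrite /spike; congr (_ + _); apply: eq_bigr => j _.
  by rewrite !mxE dist_intDz.
move=> S z /freudenthal_translate-/(_ z)[s [beta ->]].
have /cid2[a _ aP] : exists2 a : 'I_d -> R * R, True & forall j t,
    (beta ord0 j)%:~R / 2 <= t <= ((beta ord0 j)%:~R + 1) / 2 ->
    dist_int t = (a j).1 * t + (a j).2.
  have h j : exists u : R * R, forall t,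
    (beta ord0 j)%:~R / 2 <= t <= ((beta ord0 j)%:~R + 1) / 2 ->
    dist_int t = u.1 * t + u.2.
    by have [u1 [u2 hu]] := dist_int_affine R (beta ord0 j); exists (u1, u2).
  by exists (fun j => projT1 (cid (h j))) => // j; exact: projT2 (cid (h j)).
exists (\col_j (a j).1), (\sum_j (a j).2 + eps) => _ [w [w0 _ w1 ->]].
rewrite /spike addrC addrA; congr (_ + _).
rewrite [in RHS]mxE -big_split/=; apply: eq_bigr => j _.
rewrite mxE mulrC; apply: aP; rewrite kuhn_comb//.
have h0 : 0 <= \sum_(k < d.+1 | (s j < k)%N) w ord0 k by exact: sumr_ge0.
have : \sum_(k < d.+1 | (s j < k)%N) w ord0 k <= 1.
  by rewrite -w1; exact: tail_weight_le.
by lra.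
Qed.

End Spike.

(** * One-dimensional integrals of negative powers *)

Section SpikeIntegral.
Variable R : realType.

Lemma is_derive_powR_affine (c a p t : R) : 0 < c + a * t ->
  is_derive t 1 (fun u => (c + a * u) `^ p) (p * (c + a * t) `^ (p - 1) * a).
Proof.
move=> ct; have ct' : c + a * t \in `]0, +oo[ by rewrite in_itv/= ct.
have dp : is_derive (c + a * t) 1 (@powR R ^~ p) (p * (c + a * t) `^ (p - 1)).
  apply: DeriveDef; first exact: derivable_powR.
  by rewrite -derive1E powR_derive1.
have dl : is_derive t 1 (fun u : R => c + a * u) a.
  by apply: is_derive_eq; rewrite add0r mul1r /GRing.scale/= mulr1.
exact: (@is_derive1_comp R (@powR R ^~ p) (fun u => c + a * u) t _ _ dp dl).
Qed.

(** By the fundamental theorem of calculus; [a ^+ 2 = 1] lets [a] replace [1 / a] in the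
    antiderivative and covers both branches [eps + t] and [1 + eps - t]. *)
Lemma integral_powR_affine (c a s : R) : a ^+ 2 = 1 -> s < 1 ->
  (forall t : R, 0 <= t <= 1 -> 0 < c + a * t) ->
  (\int[@lebesgue_measure R]_(t in `[0%R, 1%R]) ((c + a * t) `^ (- s))%:E =
    (a / (1 - s) * ((c + a) `^ (1 - s) - c `^ (1 - s)))%:E)%E.
Proof.
move=> a2 s1 cpos; have s0 : 1 - s != 0 by rewrite subr_eq0 gt_eqF.
have aa : a * a = 1 by rewrite -expr2.
pose F t : R := a / (1 - s) * (c + a * t) `^ (1 - s).
have dF (t : R) : 0 <= t <= 1 -> is_derive t 1 F ((c + a * t) `^ (- s)).
  move=> /cpos ct; have := is_derive_powR_affine (1 - s) ct => dp.
  have := is_deriveZ (a / (1 - s)) dp => h.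
  apply: (is_derive_eq (f' := _) h); rewrite /GRing.scale/=.
  rewrite [1 - s - 1]addrAC subrr add0r.
  transitivity (a * a * (c + a * t) `^ (- s)); first by field.
  by rewrite aa mul1r.
have cF (t : R) : 0 <= t <= 1 -> {for t, continuous F}.
  move=> /dF dFt; apply: differentiable_continuous.
  by apply/derivable1_diffP; exact: ex_derive.
rewrite (@continuous_FTC2 _ _ F)//; last 3 first.
- apply: derivable_within_continuous => t; rewrite in_itv/= => /cpos ct.
  by have := is_derive_powR_affine (- s) ct => ?; exact: ex_derive.
- split.
  + move=> t; rewrite in_itv/= => /andP[t0 t1].
    by have [|? _] := dF t; first by rewrite !ltW.
  + by apply: cvg_at_right_filter; apply: cF; rewrite lexx ler01.
  + by apply: cvg_at_left_filter; apply: cF; rewrite lexx ler01.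
- move=> t; rewrite in_itv/= => /andP[t0 t1]; rewrite derive1E.
  by have [|_ ?] := dF t; first by rewrite !ltW.
by rewrite -EFinB /F mulr1 mulr0 addr0 mulrBr.
Qed.

Lemma integral_dist_int_powR (eps s : R) : 0 < eps <= 1 -> 0 <= s < 1 ->
  (\int[@lebesgue_measure R]_(t in `[0%R, 1%R]) ((eps + dist_int t) `^ (- s))%:E
    <= (4 / (1 - s))%:E)%E.
Proof.
move=> /andP[e0 e1] /andP[s0 s1].
have bnd : (1 - s)^-1 * ((1 + eps) `^ (1 - s) - eps `^ (1 - s)) <= 2 / (1 - s).
  rewrite mulrC ler_wpM2r ?invr_ge0 ?subr_ge0 ?(ltW s1)//.
  rewrite lerBlDr (@le_trans _ _ 2)//; last by rewrite lerDl powR_ge0.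
  apply: (@le_trans _ _ ((1 + eps) `^ 1)).
    by apply: ler_powR; lra.
  by rewrite powRr1; lra.
have I1 : (\int[@lebesgue_measure R]_(t in `[0%R, 1%R]) ((eps + 1 * t) `^ (- s))%:E
    <= (2 / (1 - s))%:E)%E.
  rewrite integral_powR_affine ?expr1n//; last by move=> t; lra.
  by rewrite lee_fin mul1r addrC [eps + 1]addrC in bnd *; exact: bnd.
have I2 : (\int[@lebesgue_measure R]_(t in `[0%R, 1%R])
    ((1 + eps + -1 * t) `^ (- s))%:E <= (2 / (1 - s))%:E)%E.
  rewrite integral_powR_affine ?sqrrN ?expr1n//; last by move=> t; lra.
  rewrite lee_fin; apply: le_trans bnd.
  rewrite [1 + eps - 1]addrAC subrr add0r mulN1r mulNr -mulrN opprB.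
  by [].
have mpow (c a : R) : measurable_fun (`[(0 : R), 1]%classic : set (measurableTypeR R))
    (fun t : measurableTypeR R => ((c + a * t) `^ (- s))%:E).
  apply/measurable_EFinP; apply: (measurableT_comp (measurable_powR _)).
  by apply: measurable_funD => //; exact: measurable_funM.
apply: (@le_trans _ _ (\int[@lebesgue_measure R]_(t in `[0%R, 1%R])
    (((eps + 1 * t) `^ (- s))%:E + ((1 + eps + -1 * t) `^ (- s))%:E))%E).
  apply: ge0_le_integral_nomeas => t; first by rewrite lee_fin powR_ge0.
  rewrite /= in_itv/= => t01; rewrite -EFinD lee_fin.
  have pow_le (x y : R) : 0 < x -> x <= y -> y `^ (- s) <= x `^ (- s).
    move=> x0 xy; have y0 : 0 < y by exact: lt_le_trans xy.
    rewrite !powRN lef_pV2 ?posrE ?powR_gt0//.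
    by apply: ge0_ler_powR => //; rewrite nnegrE ltW.
  have := dist_int_ge t01; rewrite ge_min => /orP[h|h].
    by apply: ler_wpDr; [exact: powR_ge0|apply: pow_le; lra].
  by apply: ler_wpDl; [exact: powR_ge0|apply: pow_le; lra].
rewrite ge0_integralD//; last 2 first.
- by move=> t _; rewrite lee_fin powR_ge0.
- by move=> t _; rewrite lee_fin powR_ge0.
apply: le_trans (leeD I1 I2) _; rewrite -EFinD lee_fin.
by rewrite -mulrDl; apply: ler_wpM2r; [rewrite invr_ge0 subr_ge0 ltW|lra].
Qed.

End SpikeIntegral.

(** * Spike integrals over the torus and failure for [q < d] *)

Section SpikeTorusIntegral.
Variables (R : realType) (d : nat).
Implicit Types (eps q K : R) (f : 'rV[R]_d -> R).

Lemma torus_integral_le f K : (forall x, 0 <= f x <= K) ->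
  (torus_integral f <= K%:E)%E.
Proof.
move=> fK; rewrite /torus_integral lebesgue_tupleE.
apply: (@le_trans _ _ (\int[lebesgue_tuple_measure R d]_(t in @unit_cube R d) K%:E)%E).
  by apply: ge0_le_integral_nomeas => t _; rewrite lee_fin; have /andP[] := fK (\row_i tnth t i).
rewrite integral_cst; last exact: measurable_unit_cube.
have : (lebesgue_tuple (@unit_cube R d) = 1)%E.
  rewrite [LHS](@lebesgue_tuple_box R d (fun=> 0) (fun=> 1))//.
  by rewrite big1// => i _; rewrite subr0.
by rewrite lebesgue_tupleE => E; rewrite [X in (_ * X <= _)%E](_ : _ = 1%E) ?mule1.
Qed.

Lemma torus_integral_spike_powR eps q : (0 < d)%N -> 0 < eps <= 1 ->
  0 <= q -> q < d%:R ->
  (torus_integral (fun x : 'rV[R]_d => spike eps x `^ (- q))%R <=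
     ((4 / (1 - q / d%:R)) ^+ d)%:E)%E.
Proof.
move=> d0 eps01 q0 qd; have /andP[e0 e1] := eps01.
have dR : 0 < d%:R :> R by rewrite ltr0n.
pose s := q / d%:R; rewrite -/s.
have s01 : 0 <= s < 1 by rewrite divr_ge0 ?ler0n// ltr_pdivrMr// mul1r.
have /andP[s0 s1] := s01.
pose I : set (measurableTypeR R) := `[(0 : R), 1]%classic.
(* The indicator restricts to the unit interval, since [lebesgue_tuple_integral_prod] integrates
   over the whole space. *)
pose g (t : measurableTypeR R) : R := (eps + dist_int t) `^ (- s) * \1_I t.
have g0 t : 0 <= g t by rewrite mulr_ge0// powR_ge0.
have mg : measurable_fun [set: measurableTypeR R] g.
  apply: measurable_funM; last first.
    by apply: measurable_indic; exact: measurable_itv.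
  apply: (measurableT_comp (measurable_powR _)).
  apply: measurable_funD => //.
  exact: (continuous_measurable_fun (@continuous_dist_int R)).
have intg : (\int[@lebesgue_measure R]_t (g t)%:E <= (4 / (1 - s))%:E)%E.
  apply: le_trans (integral_dist_int_powR eps01 s01).
  rewrite [leRHS]integral_mkcond; apply: ge0_le_integral_nomeas => t _.
    by rewrite lee_fin.
  rewrite patchE -/I /g indicE.
  by case: (t \in I); rewrite ?mulr1 ?mulr0.
apply: le_trans (lebesgue_tuple_integral_prod mg g0 intg d).
rewrite /torus_integral lebesgue_tupleE integral_mkcond.
apply: ge0_le_integral_nomeas => t _.
  by apply: erestrict_ge0 => // x _; rewrite lee_fin powR_ge0.
rewrite patchE; case: ifPn => [/set_mem tD|_]; last first.
  by rewrite lee_fin; exact: prodr_ge0.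
set x := \row_i tnth t i.
have sp0 : 0 < spike eps x := lt_le_trans e0 (spike_ge_eps eps x).
(* Sharing the exponent equally among the [d] coordinates leaves [s = q / d < 1] on each, which
   keeps the one-dimensional integrals bounded as [eps] tends to [0]. *)
have -> : spike eps x `^ (- q) = \prod_(i < d) spike eps x `^ (- s).
  rewrite prodr_const card_ord -powR_mulrn ?powR_ge0// -powRrM.
  by rewrite /s mulNr divfK// gt_eqF.
rewrite lee_fin; apply: ler_prod => i _; rewrite powR_ge0 /g indicE mem_set; last first.
  by rewrite /I /= in_itv/=; exact: tD.
rewrite mulr1.
have xi0 : 0 < eps + dist_int (tnth t i) by rewrite ltr_pwDl// dist_int_ge0.
rewrite !powRN lef_pV2 ?posrE ?powR_gt0//.
apply: ge0_ler_powR => //; rewrite ?nnegrE ?(ltW xi0) ?(ltW sp0)//.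
by have := spike_ge eps x i; rewrite mxE.
Qed.

Lemma spike_no_lower_bound q : (0 < d)%N -> q < d%:R ->
  ~ (forall C0 : R, 0 < C0 -> has_lower_bound (freudenthal_mesh R d) q C0).
Proof.
move=> d0 qd.
suff [C C0 bound] : exists2 C : R, 0 < C & forall eps, 0 < eps <= 1 ->
    (torus_integral (fun x : 'rV[R]_d => spike eps x `^ (- q))%R <= C%:E)%E.
  (* [1 + d] bounds the integral of the spike and [C] that of its power, whatever [eps] is; but the
     minimum is at most [spike eps 0 = eps <= c / 2 < c]. *)
  have D0 : 0 < 1 + d%:R + C by rewrite addr_gt0// ltr_pwDl.
  move=> /(_ _ D0)[c c0 cP]; pose eps := Num.min 1 (c / 2).
  have e0 : 0 < eps by rewrite lt_min ltr01 divr_gt0.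
  have e1 : eps <= 1 by rewrite ge_min lexx.
  have sp0 (x : 'rV[R]_d) : 0 < spike eps x := lt_le_trans e0 (spike_ge_eps eps x).
  have : c <= inf (range (@spike R d eps)).
    apply: cP => //; first exact: spike_Vh.
    rewrite EFinD; apply: leeD; last by apply: bound; rewrite e0.
    apply: torus_integral_le => x; rewrite ltW//=.
    by apply: le_trans (spike_le _ _) _; rewrite lerD2r.
  apply/negP; rewrite -ltNge; apply: (@le_lt_trans _ _ eps).
    rewrite -[leRHS](@spike0 R d eps); apply: ge_inf; last by exists 0.
    by exists 0 => _ [x _ <-]; exact: ltW.
  by rewrite gt_min; apply/orP; right; lra.
(* For [q < 0] the power [- q] is positive and increasing, so the upper bound [1 + d] on the spike
   suffices. *)
have [q0|q0] := leP 0 q.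
  exists ((4 / (1 - q / d%:R)) ^+ d) => [|eps eps01]; last first.
    exact: torus_integral_spike_powR.
  by rewrite exprn_gt0// divr_gt0// subr_gt0 ltr_pdivrMr ?mul1r// ltr0n.
exists ((1 + d%:R) `^ (- q)) => [|eps /andP[e0 e1]].
  by rewrite powR_gt0// ltr_pwDl.
apply: torus_integral_le => x; rewrite powR_ge0/=.
have sp0 : 0 <= spike eps x by exact: le_trans (ltW e0) (spike_ge_eps eps x).
apply: ge0_ler_powR; [by rewrite oppr_ge0 ltW|by rewrite nnegrE|
  by rewrite nnegrE addr_ge0|].
by apply: le_trans (spike_le _ _) _; rewrite lerD2r.
Qed.

End SpikeTorusIntegral.

Theorem lemma3p9 (R : realType) (d : nat) (hd : (1 <= d <= 3)%N) :
  (forall (T : periodic_mesh R d) (q : R), d%:R <= q ->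
     forall C0 : R, 0 < C0 -> has_lower_bound T q C0) /\
  (forall q : R, q < d%:R ->
     exists T : periodic_mesh R d,
       ~ (forall C0 : R, 0 < C0 -> has_lower_bound T q C0)).
Proof.
have /andP[d0 _] := hd; split=> [T q dq C0 C00|q qd].
  exact: has_lower_bound_ge_dim.
by exists (freudenthal_mesh R d); exact: spike_no_lower_bound.
Qed.
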